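(* Let $n$, $m$ be positive integers and suppose the following points are given: (1) $\alpha_1,\alpha_2,\dots,\alpha_{k_0}\in\mathbb{D}$ and $\eta_1,\eta_2,\dots,\eta_{k_1}\in\mathbb{T}$, where $2k_0+k_1=n$; (2) $\beta_1,\beta_2,\dots,\beta_m\in\mathbb{D}$; (3) $\sigma_1,\dots,\sigma_n\in\overline{\mathbb{D}}$ which are distinct from $\eta_1,\dots,\eta_{k_1}$. Then there exists a rational $\overline{\mathcal{P}}$-inner function $x=(a,s,p)$ of degree $\le (m+n,n)$ such that the zeros of $a$ in $\mathbb{D}$ are $\beta_1,\dots,\beta_m$, the zeros of $s$ in $\overline{\mathbb{D}}$ are $\alpha_1,\dots,\alpha_{k_0},\eta_1,\dots,\eta_{k_1}$, and the royal nodes of $(s,p)$ are $\sigma_1,\dots,\sigma_n$.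
   Context: $\mathbb{D}$ is the open unit disc in $\mathbb{C}$, $\mathbb{T}$ the unit circle. $\mathbb{B}^{2\times2}$ is the open unit ball of the space of complex $2\times2$ matrices in the operator norm (from the standard inner product on $\mathbb{C}^2$). The pentablock is the domain $\mathcal{P}=\{(a_{21},\operatorname{tr}A,\det A): A=[a_{ij}]_{i,j=1}^2\in\mathbb{B}^{2\times2}\}\subset\mathbb{C}^3$, and $\overline{\mathcal{P}}$ is its closure. The distinguished boundary of $\mathcal{P}$ is $$b\overline{\mathcal{P}}=\Big\{(a,s,p)\in\mathbb{C}^3: |s|\le2,\ |p|=1,\ s=\overline{s}p,\ |a|=\sqrt{1-\tfrac14|s|^2}\Big\}.$$ A rational $\overline{\mathcal{P}}$-inner function is a rational analytic map $x:\mathbb{D}\to\overline{\mathcal{P}}$ (which automatically extends continuously to $\overline{\mathbb{D}}$) that maps $\mathbb{T}$ into $b\overline{\mathcal{P}}$. The degree of a rational $\overline{\mathcal{P}}$-inner function $x=(a,s,p)$ is the pair $(\deg a,\deg p)$ of degrees of the rational functions $a$ and $p$; degree $\le(m,n)$ means $\deg a\le m$ and $\deg p\le n$. The royal nodes of $(s,p)$ are the points $\lambda\in\overline{\mathbb{D}}$ with $s(\lambda)^2=4p(\lambda)$, i.e. the zeros of $s^2-4p$ in $\overline{\mathbb{D}}$. *)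

(* Defs.v *)
From HB Require Import structures.
From mathcomp Require Import all_boot all_order all_algebra.
From mathcomp Require Import generic_quotient fraction complex.
From mathcomp Require Import all_classical all_reals all_analysis.

Set Implicit Arguments.
Unset Strict Implicit.
Unset Printing Implicit Defensive.

Import Order.TTheory GRing.Theory Num.Theory.
Import numFieldNormedType.Exports.

Local Open Scope quotient_scope.
Local Open Scope classical_set_scope.
Local Open Scope ring_scope.

(* In R[i] the order is partial: `|z| < 1 compares two elements with zero
   imaginary part. *)
Definition disc (R : realType) : set R[i] := [set z | `|z| < 1].
Definition closed_disc (R : realType) : set R[i] := [set z | `|z| <= 1].
Definition circle (R : realType) : set R[i] := [set z | `|z| = 1].

(** * The pentablock *)

(* MathComp-Analysis puts the usual topology of the complex plane on R[i]^o,
   which is convertible to R[i]. *)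
Definition C3 (R : realType) : Type := (R[i]^o * R[i]^o * R[i]^o)%type.

Definition l2norm (R : realType) n (v : 'cV[R[i]]_n) : R :=
  Num.sqrt (\sum_(i < n) Normc.normc (v i 0) ^+ 2).

Definition opnorm (R : realType) n (A : 'M[R[i]]_n) : R :=
  sup [set l2norm (A *m v) | v in [set v : 'cV[R[i]]_n | l2norm v <= 1]].

(* The entry a_21 is A 1 0, since indices start at 0. *)
Definition pentablock (R : realType) : set (C3 R) :=
  [set (A 1 0, \tr A, \det A) | A in [set A : 'M[R[i]]_2 | opnorm A < 1]].

Definition closed_pentablock (R : realType) : set (C3 R) :=
  @closure (R[i]^o * R[i]^o * R[i]^o)%type (@pentablock R).

Definition distinguished_boundary (R : realType) (a s p : R[i]) : Prop :=
  [/\ `|s| <= 2, `|p| = 1, s = s^* * p & `|a| = sqrtC (1 - `|s| ^+ 2 / 4)].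

(** * Rational functions of one complex variable *)

Definition ratfun (R : realType) : Type := {fraction {poly R[i]}}.

(* Numerator and denominator in lowest terms: [repr f] is some pair
   representing f, from which the common factors are removed. *)
Definition rnum (R : realType) (f : ratfun R) : {poly R[i]} :=
  (repr f).1 %/ gcdp (repr f).1 (repr f).2.
Definition rden (R : realType) (f : ratfun R) : {poly R[i]} :=
  (repr f).2 %/ gcdp (repr f).1 (repr f).2.

Lemma rden_neq0 (R : realType) (f : ratfun R) : rden f != 0.
Proof.
by rewrite /rden dvdp_div_eq0 ?dvdp_gcdr // denom_ratioP.
Qed.

Lemma coprimep_rnum_rden (R : realType) (f : ratfun R) :
  coprimep (rnum f) (rden f).
Proof.
by rewrite coprimep_div_gcd // denom_ratioP orbT.
Qed.

Lemma ratfunE (R : realType) (f : ratfun R) :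
  f = FracField.tofrac (rnum f) / FracField.tofrac (rden f).
Proof.
have d0 : FracField.tofrac (rden f) != 0 by rewrite tofrac_eq0 rden_neq0.
apply: (mulIf d0); rewrite divfK // -{1}[f]reprK !piE.
apply/eqP; rewrite eqmodE /= FracField.equivfE.
rewrite /FracField.mulf /= !numden_Ratio ?mulf_neq0 ?oner_neq0 ?denom_ratioP //.
rewrite !mulr1 -[X in X * rden f](divpK (dvdp_gcdl (repr f).1 (repr f).2)).
rewrite -[X in _ == X * _](divpK (dvdp_gcdr (repr f).1 (repr f).2)).
by rewrite -/(rnum f) -/(rden f) mulrAC [X in _ == X]mulrAC [rnum f * _]mulrC.
Qed.

Definition pole (R : realType) (f : ratfun R) (z : R[i]) : bool :=
  root (rden f) z.

(* Meaningful only where f has no pole. *)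
Definition reval (R : realType) (f : ratfun R) (z : R[i]) : R[i] :=
  (rnum f).[z] / (rden f).[z].

Definition ratdeg (R : realType) (f : ratfun R) : nat :=
  maxn (size (rnum f)).-1 (size (rden f)).-1.

(* Order of vanishing of a nonzero f at z. *)
Definition zero_order (R : realType) (f : ratfun R) (z : R[i]) : nat :=
  mup z (rnum f).

(* l lists the zeros of f in S, repeated according to multiplicity; the points
   of l are understood to lie in S.  The condition f != 0 is needed because
   mup z 0 = 0. *)
Definition zeros_in (R : realType) (S : set R[i]) (f : ratfun R)
    (l : seq R[i]) : Prop :=
  f != 0 /\ forall z, S z -> zero_order f z = count_mem z l.

(* l lists the royal nodes of (s, p) with multiplicity.  For an inner function
   the zeros of s^2 - 4p on the unit circle have even order, and a royal node
   there has as multiplicity half of this order; this is the convention for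
   which a function with deg p = n has n royal nodes. *)
Definition royal_nodes (R : realType) (s p : ratfun R) (l : seq R[i]) : Prop :=
  let r : ratfun R := s ^+ 2 - 4 * p in
  r != 0 /\ forall z, closed_disc z ->
    zero_order r z = if `|z| == 1 then (2 * count_mem z l)%N else count_mem z l.

(** * Rational inner functions *)

(* A rational map that is analytic on the open disc and takes its values in the
   bounded set closed_pentablock has no poles on the circle, so requiring
   analyticity on the closed disc excludes nothing; it makes explicit that the
   values on the circle are those of the continuous extension. *)
Definition rational_penta_inner (R : realType) (a s p : ratfun R) : Prop :=
  [/\ forall z, closed_disc z -> [/\ ~~ pole a z, ~~ pole s z & ~~ pole p z],
      forall z, disc z -> closed_pentablock (reval a z, reval s z, reval p z)
    & forall z, circle z ->
        distinguished_boundary (reval a z) (reval s z) (reval p z)].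

(* Main.v *)
Require Import Defs.
From HB Require Import structures.
From mathcomp Require Import all_boot all_order all_algebra.
From mathcomp Require Import ring lra zify.
From mathcomp Require Import complex fraction.
From mathcomp Require Import all_classical all_reals all_analysis.

Set Implicit Arguments.
Unset Strict Implicit.
Unset Printing Implicit Defensive.

Import Order.TTheory GRing.Theory Num.Theory.
Import numFieldNormedType.Exports.

Local Open Scope classical_set_scope.
Local Open Scope ring_scope.

(** The map is built from polynomials.  Write n for the number of royal nodes
    and S, T for the products of the factors z - sigma and 1 - conj(sigma) z.
    The prescribed zeros of s determine, up to a constant, a polynomial E with
    z^n conj(E(z)) = E(z) on the circle.  There z^-n (S T + E^2) equals
    |S|^2 + |E|^2, which is positive because no sigma is an eta, so the theorem
    of Fejer and Riesz ([fejer_riesz], [outer_denominator]) factors it as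
    4 |D|^2 with D zero-free on the closed disc.  If D' is the reflection
    z^n conj(D(1/conj z)) of D, this is the polynomial identity

      S T + E^2 = 4 D D',

    and with a Blaschke product b vanishing at the points beta one puts

      s = E / D,   p = D' / D,   a = b T / (2 D).

    Then s^2 - 4 p = - S T / D^2, whence the royal nodes; the zeros of s and a
    and the conditions on the circle are read off from the formulas.

    It remains to see that the disc is mapped into the closed pentablock.  When
    b is replaced by 1, the point (a, s, p) comes from the matrix

      A = [ E, -S ; T, E ] / (2 D),

    which is analytic in the disc and unitary on the circle, hence a contraction
    in the disc by the maximum principle ([contraction_on_disc]).  To insert the
    factor b one keeps trace and determinant and conjugates A(z) by a unitary
    matrix depending on z: the lower left entry of the conjugate is a quadratic
    form in a unit vector, and the vector can be chosen so that this entry is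
    b(z) times that of A(z) ([closed_pentablock_twist]).  Contractions lie in
    the closure of the open ball, so the value is in the closed pentablock.

    The maximum principle is needed only for quotients N / D of polynomials,
    and it is proved by counting linear factors: a polynomial without zeros in
    the closed disc satisfies |P(w)| <= 2^d |P(z)| when w is the radial
    projection of z to the circle.  Applied to N - c D this shows that every
    bound M > 1 for |N / D| in the disc can be improved by a fixed proportion
    of M - 1, so the supremum is at most 1. *)

(** * Polynomials with prescribed zeros and their reflections *)

Section Circle.
Variable C : numClosedFieldType.
Implicit Types (z r c : C) (s : seq C) (P Q W : {poly C}).

Definition zeros_poly s : {poly C} := \prod_(r <- s) ('X - r%:P).

(** This is z ^ d * conj (Z (1 / conj z)) for Z := [zeros_poly s] and d := [size s];
    its zeros are the reflections in the unit circle of the nonzero zeros of Z. *)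
Definition refl_poly s : {poly C} := \prod_(r <- s) (1 - r^* *: 'X).

Lemma circle_neq0 z : `|z| = 1 -> z != 0.
Proof. by move=> z1; rewrite -normr_gt0 z1. Qed.

Lemma circle_mulJ z : `|z| = 1 -> z * z^* = 1.
Proof. by move=> z1; rewrite -normCK z1 expr1n. Qed.

Lemma horner_zeros s z : (zeros_poly s).[z] = \prod_(r <- s) (z - r).
Proof. by rewrite horner_prod; apply: eq_bigr => r _; rewrite !hornerE. Qed.

Lemma horner_refl s z : (refl_poly s).[z] = \prod_(r <- s) (1 - r^* * z).
Proof. by rewrite horner_prod; apply: eq_bigr => r _; rewrite !hornerE. Qed.

Lemma root_zeros s z : root (zeros_poly s) z = (z \in s).
Proof. exact: root_prod_XsubC. Qed.

Lemma zeros_neq0 s : zeros_poly s != 0.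
Proof. exact/monic_neq0/monic_prod_XsubC. Qed.

Lemma size_zeros s : size (zeros_poly s) = (size s).+1.
Proof. exact: size_prod_XsubC. Qed.

Lemma size_refl s : (size (refl_poly s) <= (size s).+1)%N.
Proof.
elim: s => [|r s IH]; rewrite /refl_poly ?big_nil ?big_cons ?size_poly1//.
apply: leq_trans (size_polyMleq _ _) _.
have : (size (1 - r^* *: 'X : {poly C})%R <= 2)%N.
  apply: leq_trans (size_polyD _ _) _.
  rewrite size_poly1 size_polyN geq_max /=.
  by apply: leq_trans (size_scale_leq _ _) _; rewrite size_polyX.
by move=> sz2; rewrite -ltnS; case: (_ + _)%N (leq_add sz2 IH) => [|k].
Qed.

Lemma refl_circle s z : `|z| = 1 ->
  (refl_poly s).[z] = z ^+ size s * ((zeros_poly s).[z])^*.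
Proof.
move=> z1; rewrite horner_refl horner_zeros rmorph_prod.
elim: s => [|r s IH]; first by rewrite !big_nil mul1r.
rewrite !big_cons IH /= rmorphB/= exprS.
rewrite -{1}(circle_mulJ z1); ring.
Qed.

Lemma norm_refl_circle s z : `|z| = 1 ->
  `|(refl_poly s).[z]| = `|(zeros_poly s).[z]|.
Proof.
by move=> z1; rewrite refl_circle// normrM normrX z1 expr1n mul1r norm_conjC.
Qed.

Lemma refl_factor_neq0 r z : `|r * z| < 1 -> 1 - r^* * z != 0.
Proof.
move=> rz1; rewrite subr_eq0; apply/eqP => E.
by move: rz1; rewrite normrM -norm_conjC -normrM -E normr1 ltxx.
Qed.

Lemma horner_refl_neq0 s z : (forall r, r \in s -> `|r * z| < 1) ->
  (refl_poly s).[z] != 0.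
Proof.
move=> h; rewrite horner_refl prodf_seq_neq0; apply/allP => r rs /=.
exact/refl_factor_neq0/h.
Qed.

Lemma refl_poly_neq0 s : refl_poly s != 0.
Proof.
have : (refl_poly s).[0] != 0.
  by apply: horner_refl_neq0 => r _; rewrite mulr0 normr0.
by apply: contraNneq => ->; rewrite horner0.
Qed.

Lemma refl_disc_neq0 s z : (forall r, r \in s -> `|r| < 1) -> `|z| <= 1 ->
  (refl_poly s).[z] != 0.
Proof.
move=> s1 z1; apply: horner_refl_neq0 => r /s1 r1; rewrite normrM.
by rewrite (le_lt_trans _ r1)// ler_piMr.
Qed.

(** A point of the circle is its own reflection, so its two linear factors are
    proportional. *)
Lemma refl_factor_circle r : `|r| = 1 ->
  1 - r^* *: 'X = (- r^*) *: ('X - r%:P) :> {poly C}.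
Proof.
move=> r1; rewrite scalerBr scaleNr -mul_polyC -[(- _) *: _]mul_polyC -polyCM.
by rewrite mulNr [_ * r]mulrC (circle_mulJ r1) polyCN opprK addrC mul_polyC.
Qed.

(** A zero inside the disc is reflected to the outside, while a zero on the circle
    stays; this produces the double zeros of S T at royal nodes on the circle. *)
Lemma mup_refl s z : (forall r, r \in s -> `|r| <= 1) -> `|z| <= 1 ->
  mup z (refl_poly s) = if `|z| == 1 then count_mem z s else 0%N.
Proof.
move=> s1 z1; elim: s s1 => [|r s IH] s1.
  by rewrite /refl_poly big_nil mupNroot ?root1//; case: ifP.
have {}IH : mup z (refl_poly s) = if `|z| == 1 then count_mem z s else 0%N.
  by apply: IH => x xs; apply: s1; rewrite inE xs orbT.
have r1 := s1 r (mem_head _ _).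
have nz x : `|x * z| < 1 -> ~~ root (1 - x^* *: 'X) z.
  by move=> h; rewrite /root !hornerE refl_factor_neq0.
have red : `|r * z| < 1 -> mup z (refl_poly (r :: s)) = mup z (refl_poly s).
  by move=> h; rewrite /refl_poly big_cons mupMr// nz.
have [zE|zN] := eqVneq `|z| 1; last first.
  rewrite red ?IH ?(negPf zN)// normrM.
  apply: le_lt_trans (_ : 1 * `|z| < 1); first by rewrite ler_wpM2r.
  by rewrite mul1r lt_neqAle zN.
have [rE|rN] := eqVneq `|r| 1; last first.
  rewrite red ?IH ?zE ?eqxx//=; last by rewrite normrM zE mulr1 lt_neqAle rN.
  have [rz|//] := eqVneq r z; by rewrite rz zE eqxx in rN.
have rJ0 : ~~ root (- r^*)%:P z.
  by rewrite rootC oppr_eq0 conjC_eq0 circle_neq0.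
have E : refl_poly (r :: s) = (- r^*)%:P * (('X - r%:P) * refl_poly s).
  by rewrite /refl_poly big_cons refl_factor_circle// -mul_polyC mulrA.
rewrite E mupMr// mupM ?polyXsubC_eq0 ?refl_poly_neq0// IH zE eqxx.
by rewrite (@mup_XsubCX _ 1) /=; case: eqVneq.
Qed.

(** * The theorem of Fejer and Riesz *)

(** The circle is infinite. *)
Lemma poly_eq_circle P Q : (forall z, `|z| = 1 -> P.[z] = Q.[z]) -> P = Q.
Proof.
move=> PQ; apply/eqP; rewrite -subr_eq0; apply/negPn/negP => d0.
(* The Cayley transform maps the natural numbers to distinct points of the circle. *)
pose f (t : nat) : C := (1 + 'i * t%:R) / (1 - 'i * t%:R).
have J (t : nat) : (1 - 'i * t%:R : C)^* = 1 + 'i * t%:R.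
  by rewrite rmorphB rmorphM /= conjCi conjC1 conjC_nat mulNr opprK.
have nz (t : nat) : 1 - 'i * t%:R != 0 :> C.
  apply/eqP => e0; have e0' := congr1 Num.conj e0.
  rewrite J conjC0 in e0'.
  have : (1 + 1 : C) = 0 by rewrite -[RHS](addr0 0) -{1}e0 -e0'; ring.
  by move/eqP; rewrite -(natrD _ 1 1) pnatr_eq0.
have f1 (t : nat) : `|f t| = 1 by rewrite normrM normfV -J norm_conjC divff ?normr_eq0.
have f_inj : injective f.
  move=> t u; rewrite /f => /eqP; rewrite eqr_div// => /eqP E.
  have : 2 * 'i * (t%:R - u%:R) = 0 :> C.
    by rewrite -(subrr ((1 + 'i * t%:R) * (1 - 'i * u%:R))) {2}E; ring.
  move/eqP; rewrite !mulf_eq0 pnatr_eq0 /= (negPf (neq0Ci _)) /= subr_eq0.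
  by rewrite eqr_nat => /eqP.
have := @max_poly_roots _ (P - Q) [seq f t | t <- iota 0 (size (P - Q))] d0.
rewrite size_map size_iota ltnn => no; suff: false by []; apply: no.
  by apply/allP => _ /mapP[t _ ->]; rewrite /root !hornerE PQ ?subrr.
by rewrite map_inj_uniq ?iota_uniq.
Qed.

(** On the circle conj z = 1 / z, so conjugating z^-N W(z), which is real there,
    reverses the coefficients of W and conjugates them. *)
Lemma self_reciprocal_coef N W : (size W <= (2 * N).+1)%N ->
  (forall z, `|z| = 1 -> W.[z] * z^* ^+ N \is Num.real) ->
  forall i, (i <= 2 * N)%N -> W`_i = (W`_(2 * N - i))^*.
Proof.
move=> szW Wr j j2N; pose V := \poly_(i < (2 * N).+1) (W`_(2 * N - i))^*.
suff E : W = V by rewrite {1}E coef_poly ltnS j2N.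
apply: poly_eq_circle => z z1.
have zJ := circle_mulJ z1.
have -> : V.[z] = z ^+ (2 * N) * (W.[z])^*.
  rewrite (horner_coef_wide _ szW) (horner_coef_wide _ (size_poly _ _)).
  rewrite (reindex_inj rev_ord_inj) /= rmorph_sum mulr_sumr.
  apply: eq_bigr => i _; rewrite coef_poly subSS ltnS leq_subr rmorphM rmorphXn /=.
  rewrite subKn -1?ltnS// mulrCA; congr (_ * _).
  have : (i <= 2 * N)%N by rewrite -ltnS.
  move: (nat_of_ord i) => k k2N; rewrite -{2}(subnK k2N) exprD.
  by rewrite -mulrA -exprMn zJ expr1n mulr1.
have /CrealP := Wr _ z1; rewrite rmorphM rmorphXn /= conjCK => E.
have -> : z ^+ (2 * N) * (W.[z])^* = z ^+ N * (W.[z] * z^* ^+ N).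
  by rewrite -E mul2n -addnn exprD; ring.
by rewrite mulrCA -exprMn zJ expr1n mulr1.
Qed.

Lemma reflect_root N W r : (size W <= (2 * N).+1)%N ->
  (forall z, `|z| = 1 -> W.[z] * z^* ^+ N \is Num.real) ->
  r != 0 -> root W r -> root W (r^*)^-1.
Proof.
move=> szW Wr r0 /eqP rW.
have rJ0 : r^* != 0 by rewrite conjC_eq0.
suff E : r^* ^+ (2 * N) * W.[(r^*)^-1] = (W.[r])^*.
  by move/eqP: E; rewrite rW conjC0 mulf_eq0 expf_eq0 (negPf rJ0) andbF.
rewrite !(horner_coef_wide _ szW) mulr_sumr rmorph_sum.
rewrite (reindex_inj rev_ord_inj) /=; apply: eq_bigr => i _.
have i2N : (i <= 2 * N)%N by rewrite -ltnS.
have E := self_reciprocal_coef szW Wr i2N.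
rewrite subSS rmorphM rmorphXn/= [in RHS]E conjCK mulrCA; congr (_ * _).
move: (nat_of_ord i) i2N => k k2N.
by rewrite -{1}(subnK k2N) exprD mulrAC -exprMn mulfV// expr1n mul1r.
Qed.

(** The factor belonging to r and its reflection; up to z it is |z - r|^2 on the
    circle, so it can be divided out without losing positivity. *)
Definition pair_poly r : {poly C} := ('X - r%:P) * (1 - r^* *: 'X).

Lemma horner_pair r z : (pair_poly r).[z] = (z - r) * (1 - r^* * z).
Proof. by rewrite /pair_poly !hornerE. Qed.

Lemma pair_circle r z : `|z| = 1 -> (pair_poly r).[z] * z^* = `|z - r| ^+ 2.
Proof.
move=> z1; rewrite horner_pair normCK rmorphB -mulrA; congr (_ * _).
by rewrite mulrBl mul1r -mulrA (circle_mulJ z1) mulr1.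
Qed.

(** Zeros come in pairs that are symmetric in the circle and none lies on it, so
    there is one in the open disc.  The zero at 0 is paired with infinity: the
    top coefficient vanishes along with the constant one, and this accounts for
    the degree lost when only one linear factor is removed. *)
Lemma pair_dvd N W : (size W <= (2 * N.+1).+1)%N ->
  (forall z, `|z| = 1 -> 0 < W.[z] * z^* ^+ N.+1) ->
  exists r V, [/\ `|r| < 1, W = V * pair_poly r & (size V <= (2 * N).+1)%N].
Proof.
move=> szW Wpos.
have Wr z : `|z| = 1 -> W.[z] * z^* ^+ N.+1 \is Num.real.
  by move=> /Wpos /gtr0_real.
have Wn z : `|z| = 1 -> ~~ root W z.
  by move=> /Wpos; apply: contraTN => /eqP->; rewrite mul0r ltxx.
have E0 : W`_0 = (W`_(2 * N.+1))^*.
  by rewrite (self_reciprocal_coef szW Wr (leq0n _)) subn0.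
have [W0|W0] := eqVneq W`_0 0.
  have /factor_theorem[V WV] : root W 0 by rewrite /root horner_coef0 W0.
  exists 0, V; split; first by rewrite normr0 ltr01.
    by rewrite WV /pair_poly conjC0 scale0r [1 - 0]subr0 mulr1.
  have [->|V0] := eqVneq V 0; first by rewrite size_poly0.
  (* The coefficient of degree 2 * N.+1 is the conjugate of the constant one. *)
  have : (size W <= 2 * N.+1)%N.
    apply/leq_sizeP => j; rewrite leq_eqVlt => /orP[/eqP<-|].
      by apply/eqP; rewrite -conjC_eq0 -E0 W0.
    exact: (leq_sizeP _ _ szW).
  by rewrite WV size_Mmonic ?monicXsubC// size_XsubC; lia.
have W2 : W`_(2 * N.+1) != 0 by rewrite -conjC_eq0 -E0.
have /closed_rootP[r0 r0W] : size W != 1%N.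
  by apply: contraNneq W2 => sz1; rewrite nth_default// sz1; lia.
have nz x : root W x -> x != 0.
  by apply: contraTneq => ->; rewrite /root horner_coef0.
have [r [r1 rW r'W]] : exists r, [/\ `|r| < 1, root W r & root W (r^*)^-1].
  have r0'W := reflect_root szW Wr (nz _ r0W) r0W.
  have := real_ltgtP (normr_real r0) (@real1 C); case=> h.
  - by exists r0.
  - exists (r0^*)^-1; split=> //.
      by rewrite normfV norm_conjC invf_lt1// (lt_trans ltr01).
    by rewrite fmorphV /= conjCK invrK.
  - by have := Wn _ h; rewrite r0W.
have rn := nz _ rW.
have rJ0 : r^* != 0 by rewrite conjC_eq0.
have [V1 E1] := factor_theorem _ _ rW.
have /factor_theorem[V E2] : root V1 (r^*)^-1.
  move: r'W; rewrite E1 rootM root_XsubC => /orP[//|/eqP e].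
  have := mulr_ilt1 (normr_ge0 r) (normr_ge0 r) r1 r1.
  by rewrite -{1}e normfV norm_conjC mulVf ?normr_eq0// ltxx.
have E : W = (- (r^*)^-1 *: V) * pair_poly r.
  have -> : pair_poly r = (- r^*) *: (('X - (r^*)^-1%:P) * ('X - r%:P)).
    rewrite /pair_poly [LHS]mulrC scalerAl; congr (_ * _).
    rewrite scalerBr !scaleNr -!mul_polyC -polyCM mulfV//; ring.
  by rewrite -scalerAl -scalerAr scalerA mulNr mulrN opprK mulVf// scale1r E1 E2 mulrA.
exists r, (- (r^*)^-1 *: V); split=> //.
rewrite size_scale ?oppr_eq0 ?invr_eq0//.
have [->|V0] := eqVneq V 0; first by rewrite size_poly0.
move: szW; rewrite E1 E2 !size_Mmonic ?monicXsubC// ?mulf_neq0 ?polyXsubC_eq0//.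
by rewrite !size_XsubC !addnS !addn0 /= mulnS; move: (size V) (2 * N)%N => x y; lia.
Qed.

(** Positivity of z^-N W(z) on the circle is expressed with conj z instead of
    1 / z.  The right-hand side is z^N c |P(z)|^2 there, for P := [refl_poly s],
    which is zero-free on the closed disc. *)
Lemma fejer_riesz N W : (size W <= (2 * N).+1)%N ->
  (forall z, `|z| = 1 -> 0 < W.[z] * z^* ^+ N) ->
  exists c s, [/\ 0 < c, size s = N, forall r, r \in s -> `|r| < 1
    & W = c *: (zeros_poly s * refl_poly s)].
Proof.
elim: N W => [|N IH] W szW Wpos.
  have /size1_polyC E : (size W <= 1)%N by [].
  exists W`_0, [::]; split=> //.
    by have := Wpos 1 (normr1 _); rewrite E hornerC expr0 mulr1 coefC.
  by rewrite {1}E /zeros_poly /refl_poly !big_nil mulr1 alg_polyC.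
have [r [V [r1 WV szV]]] := pair_dvd szW Wpos.
have [z z1|c [s [c0 ss s1 VE]]] := IH V szV.
  have := Wpos _ z1; rewrite WV hornerM exprSr mulrACA pair_circle//.
  rewrite mulrC pmulr_rgt0// exprn_gt0// normr_gt0 subr_eq0.
  by apply: contraTneq r1 => <-; rewrite z1 ltxx.
exists c, (r :: s); split; rewrite /= ?ss//.
  by move=> x; rewrite inE => /orP[/eqP->|/s1].
rewrite WV VE /zeros_poly /refl_poly !big_cons -scalerAl mulrC /pair_poly.
by rewrite [in RHS]mulrACA.
Qed.

End Circle.

(** * The maximum principle for quotients of polynomials *)

Section Bounds.
Variable C : numClosedFieldType.
Implicit Types (z : C) (P N D : {poly C}).

Lemma root_norm_gt1 P : (forall z, `|z| <= 1 -> P.[z] != 0) ->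
  exists s, P = lead_coef P *: zeros_poly s /\ forall r, r \in s -> 1 < `|r|.
Proof.
move=> P0; have [s E] := closed_field_poly_normal P; exists s; split=> // r rs.
rewrite real_ltNge ?real1 ?normr_real//; apply/negP => /P0.
by rewrite E hornerZ horner_zeros (big_rem r)//= subrr mul0r mulr0 eqxx.
Qed.

(** For a zero r outside the disc, the radial projection w of z satisfies
    |w - z| = 1 - |z| <= |z - r|, so that |w - r| <= 2 |z - r|.  The constant does
    not depend on z, even near the circle. *)
Lemma radial_lower_bound d P z : (size P <= d.+1)%N ->
  (forall w, `|w| <= 1 -> P.[w] != 0) -> `|z| < 1 ->
  exists2 w, `|w| = 1 & `|P.[w]| <= 2 ^+ d * `|P.[z]|.
Proof.
move=> szP P0 z1.
have [w w1 wz] : exists2 w : C, `|w| = 1 & `|w - z| = 1 - `|z|.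
  have [->|zn] := eqVneq z 0.
    by exists 1; rewrite ?normr1// normr0 !subr0 normr1.
  have nz : `|z| != 0 by rewrite normr_eq0.
  exists (z / `|z|); first by rewrite normrM normfV normr_id divff.
  have -> : z / `|z| - z = z / `|z| * (1 - `|z|) by rewrite mulrBr mulr1 divfK.
  by rewrite !normrM normfV normr_id divff// mul1r ger0_norm// subr_ge0 ltW.
exists w => //.
have [s [E s1]] := root_norm_gt1 P0.
have Pn : lead_coef P != 0.
  rewrite lead_coef_eq0; apply: contraTneq (P0 0 _); last by rewrite normr0 ler01.
  by move=> ->; rewrite horner0 eqxx.
have sd : (size s <= d)%N by move: szP; rewrite E size_scale// size_zeros.
rewrite E !hornerZ !normrM mulrCA ler_wpM2l// !horner_zeros.
apply: (@le_trans _ _ (2 ^+ size s * `|\prod_(r <- s) (z - r)|)); last first.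
  by rewrite ler_wpM2r// ler_weXn2l// ler1n.
elim: s s1 {E sd} => [|r s IH] s1; first by rewrite !big_nil expr0 mul1r.
rewrite !big_cons !normrM exprS mulrACA ler_pM//; last first.
  by apply: IH => x xs; apply: s1; rewrite inE xs orbT.
have /ltW r1 := s1 r (mem_head _ _).
rewrite (_ : w - r = (w - z) + (z - r)); last by ring.
rewrite (le_trans (ler_normD _ _))// wz mulrDl mul1r lerD2r.
rewrite (le_trans (lerB r1 (lexx _)))//.
by rewrite distrC (le_trans _ (lerB_dist _ _)).
Qed.

Lemma bounded_on_disc P :
  exists2 B, 0 < B & forall z, `|z| <= 1 -> `|P.[z]| <= B.
Proof.
elim/poly_ind: P => [|P c [B B0 PB]].
  by exists 1 => // z _; rewrite horner0 normr0 ler01.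
exists (B + `|c|) => [|z z1]; first by rewrite ltr_wpDr.
rewrite hornerMXaddC (le_trans (ler_normD _ _))// lerD2r normrM.
by rewrite -[B]mulr1 ler_pM// PB.
Qed.

Lemma bounded_below_on_disc P : (forall z, `|z| <= 1 -> P.[z] != 0) ->
  exists2 b, 0 < b & forall z, `|z| <= 1 -> b <= `|P.[z]|.
Proof.
move=> P0; have [s [E s1]] := root_norm_gt1 P0.
exists (`|lead_coef P| * \prod_(r <- s) (`|r| - 1)).
  rewrite mulr_gt0//.
    rewrite normr_gt0 lead_coef_eq0.
    apply: contraTneq (P0 0 _); last by rewrite normr0 ler01.
    by move=> ->; rewrite horner0 eqxx.
  by rewrite big_seq; apply: prodr_gt0 => r rs; rewrite subr_gt0 s1.
move=> z z1; rewrite {2}E hornerZ normrM ler_wpM2l// horner_zeros normr_prod.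
rewrite big_seq [leRHS]big_seq; apply: ler_prod => r /s1 r1.
rewrite subr_ge0 ltW//= distrC (le_trans _ (lerB_dist _ _))//.
by rewrite lerD2l lerN2.
Qed.

(** Let f := N / D satisfy |f| < M in the disc, and let c have modulus M and the
    argument of f(z).  Then N - c D has no zeros in the closed disc, and
    comparing its values at z and at the radial projection of z bounds
    M - |f(z)| from below by a multiple of M - 1. *)
Lemma ratio_bound_improves N D : (forall z, `|z| <= 1 -> D.[z] != 0) ->
  (forall z, `|z| = 1 -> `|N.[z]| <= `|D.[z]|) ->
  exists2 K, 0 < K <= 1 & forall M, 1 < M ->
    (forall z, `|z| < 1 -> `|N.[z]| < M * `|D.[z]|) ->
    forall z, `|z| < 1 -> `|N.[z]| <= (M - K * (M - 1)) * `|D.[z]|.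
Proof.
move=> D0 ND.
have [B B0 DB] := bounded_on_disc D.
have [b b0 bD] := bounded_below_on_disc D0.
have bB : b <= B by rewrite (le_trans (bD 0 _) (DB 0 _))// normr0 ler01.
pose d := maxn (size N) (size D).
have d2 : 0 < 2 ^+ d :> C by rewrite exprn_gt0.
exists (b / (B * 2 ^+ d)).
  rewrite divr_gt0 ?mulr_gt0//= ler_pdivrMr ?mulr_gt0// mul1r.
  by rewrite (le_trans bB)// ler_peMr ?(ltW B0)// exprn_ege1// ler1n.
move=> M M1 NM z z1.
have M0 : 0 < M := lt_trans ltr01 M1.
have z1' := ltW z1.
have Dz := D0 z z1'.
have Dz0 : 0 < `|D.[z]| by rewrite normr_gt0.
have M10 : 0 < M - 1 by rewrite subr_gt0.
suff H : (M - 1) * b <= 2 ^+ d * (M * `|D.[z]| - `|N.[z]|).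
  have : (M - 1) * b / B * `|D.[z]| <= 2 ^+ d * (M * `|D.[z]| - `|N.[z]|).
    apply: le_trans H; rewrite -mulrA ler_piMr//.
      by rewrite mulr_ge0// ltW.
    by rewrite mulrC ler_pdivrMr// mul1r DB.
  rewrite -ler_pdivrMl// => H'; rewrite mulrBl lerBrDr addrC -lerBrDr.
  rewrite (le_trans _ H')// le_eqVlt; apply/orP; left; apply/eqP.
  by field; rewrite !gt_eqF.
have [Nz|Nz] := eqVneq N.[z] 0.
  rewrite Nz normr0 subr0 mulrCA ler_pM//.
  - exact: ltW.
  - exact: ltW.
  - by rewrite gerBl ler01.
  apply: (le_trans (bD z z1')).
  by rewrite ler_peMl// exprn_ege1// ler1n.
have Nz0 : `|N.[z]| != 0 by rewrite normr_eq0.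
have Dz' : `|D.[z]| != 0 by rewrite normr_eq0.
(* f is the value of N / D at z and c has modulus M and the argument of f. *)
have [f fE] : exists f, N.[z] = f * D.[z] by exists (N.[z] / D.[z]); rewrite divfK.
have f0 : `|f| != 0 by move: Nz0; rewrite fE normrM mulf_eq0 negb_or => /andP[].
have [c cE] : exists c, c = M * f / `|f| by exists (M * f / `|f|).
have cM : `|c| = M by rewrite cE !normrM normfV normr_id mulfK// gtr0_norm.
have szP : (size (N - c *: D)%R <= d.+1)%N.
  rewrite (leq_trans (size_polyD _ _))// size_polyN geq_max leqW ?leq_maxl//=.
  by rewrite (leq_trans (size_scale_leq _ _))// leqW// leq_maxr.
have [w w1|w w1] := radial_lower_bound szP _ z1.
  rewrite hornerD hornerN hornerZ subr_eq0; apply/eqP => E.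
  have E' : `|N.[w]| = M * `|D.[w]| by rewrite E normrM cM.
  move: w1; rewrite le_eqVlt => /orP[/eqP w1|/NM]; last by rewrite E' ltxx.
  have := ND _ w1; rewrite E' ger_pMl ?(lt_geF M1)//.
  by rewrite normr_gt0 D0// w1.
rewrite !hornerD !hornerN !hornerZ.
(* c D(z) is the multiple of N(z) by the real number M / |f|. *)
have -> : N.[z] - c * D.[z] = N.[z] * (1 - M / `|f|).
  by rewrite cE fE; field.
have fM : `|f| <= M by rewrite -(ler_pM2r Dz0) -normrM -fE ltW// NM.
rewrite normrM [`|1 - _|]distrC (@ger0_norm _ (_ - 1)) ?subr_ge0; last first.
  by rewrite ler_pdivlMr ?mul1r// lt_neqAle eq_sym f0 normr_ge0.
have -> : `|N.[z]| * (M / `|f| - 1) = M * `|D.[z]| - `|N.[z]|.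
  by rewrite fE normrM; field.
apply: le_trans; rewrite distrC.
apply: le_trans (lerB_dist _ _); rewrite normrM cM.
apply: (@le_trans _ _ ((M - 1) * `|D.[w]|)).
  by rewrite ler_wpM2l ?bD ?w1// ltW.
by rewrite mulrBl mul1r lerD2l lerN2 ND.
Qed.
End Bounds.

(** The supremum of |N / D| over the disc, if larger than 1, would be improved by
    [ratio_bound_improves]. *)
Lemma maximum_modulus (R : realType) (N D : {poly R[i]}) :
  (forall z, `|z| <= 1 -> D.[z] != 0) ->
  (forall z, `|z| = 1 -> `|N.[z]| <= `|D.[z]|) ->
  forall z, `|z| < 1 -> `|N.[z]| <= `|D.[z]|.
Proof.
move=> D0 ND.
have [K0 /andP[K0_gt _] improve] := ratio_bound_improves D0 ND.
have nE (z : R[i]) : `|z| = (Normc.normc z)%:C%C by [].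
pose K : R := complex.Re K0.
have KE : K0 = K%:C%C by rewrite RRe_real// gtr0_real.
have K_gt0 : 0 < K by rewrite -ltcR -KE.
pose f (z : R[i]) := Normc.normc (N.[z] / D.[z]).
have fE z t : `|z| < 1 -> (f z <= t) = (`|N.[z]| <= t%:C%C * `|D.[z]|).
  move=> z1; rewrite -lecR /f -nE normrM normfV ler_pdivrMr//.
  by rewrite normr_gt0 D0// ltW.
have fEl z t : `|z| < 1 -> (f z < t) = (`|N.[z]| < t%:C%C * `|D.[z]|).
  move=> z1; rewrite -ltcR /f -nE normrM normfV ltr_pdivrMr//.
  by rewrite normr_gt0 D0// ltW.
pose E := [set f z | z in [set z : R[i] | `|z| < 1]]%classic.
have E0 : (E !=set0)%classic by exists (f 0), 0 => //=; rewrite normr0 ltr01.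
have Eub : has_ubound E.
  have [B B0 NB] := bounded_on_disc N.
  have [b b0 bD] := bounded_below_on_disc D0.
  exists (complex.Re (B / b)) => _ [z z1 <-].
  rewrite fE// RRe_real ?gtr0_real ?divr_gt0//.
  rewrite (le_trans (NB z (ltW z1)))// mulrAC -mulrA ler_peMr ?(ltW B0)//.
  by rewrite ler_pdivlMr// mul1r bD// ltW.
have Esup z : `|z| < 1 -> f z <= sup E.
  by move=> z1; apply: ub_le_sup => //; exists z.
suff S1 : sup E <= 1.
  by move=> z z1; have := le_trans (Esup z z1) S1; rewrite fE// mul1r.
rewrite leNgt; apply/negP => S1.
set S := sup E in S1 Esup.
(* [ratio_bound_improves] needs a strict bound, hence S + e; half of the gain
   K * (S - 1) compensates for e. *)
pose e := K * (S - 1) / 2.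
have e0 : 0 < e by rewrite divr_gt0// mulr_gt0// subr_gt0.
have : S <= S + e - K * (S + e - 1).
  apply: ge_sup => // _ [z z1 <-]; rewrite fE//.
  rewrite rmorphB rmorphM rmorphB /= -KE.
  apply: improve => // [|w w1].
    by rewrite -[1]/(1%:C%C) ltcR (lt_trans S1)// ltrDl.
  by rewrite -fEl// (le_lt_trans (Esup w w1))// ltrDl.
have : 0 < K * e by rewrite mulr_gt0.
have : K * (S - 1) = 2 * e by rewrite /e; field.
lra.
Qed.

(** * Contractions and the closed pentablock *)

(** Stated over an abstract field so that the topology on the scalars is that of
    the field itself. *)
Lemma cvg_scale_quad (K : numFieldType) (x y z : K) :
  ((t * x, t * y, t * t * z) : K^o * K^o * K^o) @[t --> (1 : K^o)] -->
  ((1 * x, 1 * y, 1 * 1 * z) : K^o * K^o * K^o).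
Proof.
have c : (t : K^o) @[t --> (1 : K^o)] --> (1 : K^o) by exact: cvg_id.
exact: (cvg_pair (cvg_pair (cvgMr_tmp (b := x) c) (cvgMr_tmp (b := y) c))
  (cvgMr_tmp (b := z) (cvgM c c))).
Qed.

Section Contraction.
Variable R : realType.
Local Notation C := (R[i]).

(** The matrix [ a, b ; c, d ] has operator norm at most 1. *)
Definition contraction (a b c d : C) := forall v w : C,
  `|a * v + b * w| ^+ 2 + `|c * v + d * w| ^+ 2 <= `|v| ^+ 2 + `|w| ^+ 2.

Lemma sqr_l2norm n (v : 'cV[C]_n) :
  (l2norm v ^+ 2)%:C%C = \sum_(i < n) `|v i 0| ^+ 2.
Proof.
rewrite /l2norm sqr_sqrtr; last by apply: sumr_ge0 => i _; rewrite sqr_ge0.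
by rewrite rmorph_sum; apply: eq_bigr => i _; rewrite rmorphXn.
Qed.

Lemma opnorm_le (A : 'M[C]_2) (t : R) : 0 <= t ->
  (forall v : 'cV_2, \sum_(i < 2) `|(A *m v) i 0| ^+ 2 <=
     (t ^+ 2)%:C%C * \sum_(i < 2) `|v i 0| ^+ 2) -> opnorm A <= t.
Proof.
move=> t0 At; apply: ge_sup.
  exists (l2norm (A *m 0)), 0 => //=.
  by rewrite /l2norm big1 ?sqrtr0 ?ler01// => i _; rewrite mxE Normc.normc0 expr0n.
move=> _ [v /= v1 <-].
have l0 (u : 'cV[C]_2) : 0 <= l2norm u by rewrite sqrtr_ge0.
rewrite -(@ler_pXn2r _ 2)// ?nnegrE// -lecR sqr_l2norm.
apply: le_trans (At v) _; rewrite -sqr_l2norm -rmorphM lecR ler_piMr ?sqr_ge0//.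
by rewrite expr_le1.
Qed.

(** A contraction A is the limit of the matrices t A, t < 1, of the open ball. *)
Lemma closed_pentablock_contraction a b c d : contraction a b c d ->
  closed_pentablock (c, a + d, a * d - b * c).
Proof.
move=> Kon.
pose phi (t : C^o) : C^o * C^o * C^o := (t * c, t * (a + d), t * t * (a * d - b * c)).
have phi1 : phi t @[t --> (1 : C^o)] --> phi 1.
  exact: cvg_scale_quad.
have -> : (c, a + d, a * d - b * c) = phi 1 by rewrite /phi !mul1r.
move=> B /phi1 /nbhs_ballP[e /= e0 He].
pose er : R := complex.Re e.
have eE : e = er%:C%C by rewrite RRe_real// gtr0_real.
have er0 : 0 < er by rewrite -ltcR -eE.
have [t tE] : exists t : R, t = 1 - Num.min (er / 2) (1 / 2) by eexists.
have m0 : 0 < Num.min (er / 2) (1 / 2) by rewrite lt_min !divr_gt0.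
have t0 : 0 <= t.
  by rewrite tE subr_ge0 ge_min; apply/orP; right; lra.
have t1 : t < 1 by rewrite tE gtrBl.
exists (phi t%:C%C); split; last first.
  apply: He; rewrite /ball /= eE.
  have -> : 1 - t%:C%C = (1 - t)%:C%C :> C by rewrite rmorphB rmorph1.
  rewrite tE subKr normc_def /= expr0n addr0 sqrtr_sqr ltcR gtr0_norm//.
  by rewrite gt_min; apply/orP; left; lra.
pose A : 'M[C]_2 := \matrix_(i, j) (t%:C%C *
  (if i == 0 then if j == 0 then a else b else if j == 0 then c else d)).
exists A => /=.
  apply: le_lt_trans t1; apply: opnorm_le => // v.
  rewrite !big_ord_recl !big_ord0 !addr0 !mxE !big_ord_recl !big_ord0 !mxE /= !addr0.
  set v0 := v ord0 0; set v1 := v (lift ord0 ord0) 0.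
  have -> (x y : C) : t%:C%C * x * v0 + t%:C%C * y * v1 = t%:C%C * (x * v0 + y * v1).
    by ring.
  have -> (x y : C) : t%:C%C * x * v0 + t%:C%C * y * v1 = t%:C%C * (x * v0 + y * v1).
    by ring.
  rewrite !normrM !exprMn -!mulrDr.
  have -> : `|t%:C%C : C| = t%:C%C by rewrite ger0_norm// ler0c.
  by rewrite rmorphXn ler_wpM2l// exprn_ge0// ler0c.
rewrite /phi (expand_det_row _ 0) /mxtrace !big_ord_recl !big_ord0 /cofactor.
rewrite !det_mx11 !mxE /=.
congr (_, _, _); rewrite ?addr0//; ring.
Qed.
End Contraction.

Section Twist.
Variable C : numClosedFieldType.
Implicit Types (x y v w b g : C).

(** The matrix [ x, -conj y ; y, conj x ] is unitary. *)
Lemma isometry_unitary2 x y v w : `|x| ^+ 2 + `|y| ^+ 2 = 1 ->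
  `|x * v - y^* * w| ^+ 2 + `|y * v + x^* * w| ^+ 2 = `|v| ^+ 2 + `|w| ^+ 2.
Proof.
move=> xy1; rewrite -[RHS]mul1r -xy1 !normCK rmorphB !rmorphD !rmorphM /= !conjCK.
by ring.
Qed.

Lemma cauchy_schwarz2 x y v w :
  `|x * v + y * w| ^+ 2 <= (`|x| ^+ 2 + `|y| ^+ 2) * (`|v| ^+ 2 + `|w| ^+ 2).
Proof.
have -> : (`|x| ^+ 2 + `|y| ^+ 2) * (`|v| ^+ 2 + `|w| ^+ 2) =
    `|x * v + y * w| ^+ 2 + `|y^* * v - x^* * w| ^+ 2.
  by rewrite !normCK rmorphB !rmorphD !rmorphM /= !conjCK; ring.
by rewrite lerDl exprn_ge0.
Qed.

Lemma exists_phase b : exists2 g, `|g| = 1 & b * g = `|b|.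
Proof.
have [->|b0] := eqVneq b 0; first by exists 1; rewrite ?normr1 ?mul0r ?normr0.
have nb : `|b| != 0 by rewrite normr_eq0.
exists (b^* / `|b|); first by rewrite normrM normfV norm_conjC normr_id divff.
by rewrite mulrA -normCK expr2 mulfK.
Qed.

(** At x = 1, y = 0 the form has the value a; choosing the arguments of x ^ 2 and
    y ^ 2 so that the two terms cancel, its modulus runs down to 0 as weight is
    shifted from x to y.  The hypothesis a != 0 keeps the denominator
    |a| + |b| of the weights positive. *)
Lemma exists_twist a b beta : a != 0 -> `|beta| <= 1 ->
  exists x y : C, `|x| ^+ 2 + `|y| ^+ 2 = 1 /\ a * x ^+ 2 - b * y ^+ 2 = beta * a.
Proof.
move=> a0 beta1.
have [g g1 bg] := exists_phase b.
have [e [e1 be]] : exists e, `|e| = 1 /\ beta = `|beta| * e.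
  have [f f1 <-] := exists_phase beta; exists f^*.
  by rewrite norm_conjC -mulrA circle_mulJ// mulr1.
have na : 0 < `|a| by rewrite normr_gt0.
have ab : 0 < `|a| + `|b| by rewrite ltr_pwDl.
have ab0 : `|a| + `|b| != 0 by rewrite gt_eqF.
(* X and Y are the squares of x and y; the factors e and g fix the arguments, and
   the moduli solve |X| + |Y| = 1 and |a| |X| - |b| |Y| = |beta| |a|. *)
pose X := e * ((`|beta| * `|a| + `|b|) / (`|a| + `|b|)).
pose Y := e * a * g * ((1 - `|beta|) / (`|a| + `|b|)).
exists (sqrtC X), (sqrtC Y); rewrite -!normrX !sqrtCK; split.
  rewrite /X /Y !normrM e1 g1 normfV (ger0_norm (ltW ab)).
  rewrite [`|_ + _|]ger0_norm ?addr_ge0 ?mulr_ge0//.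
  by rewrite [`|1 - _|]ger0_norm ?subr_ge0//; field.
have -> : a * X - b * Y =
    e * a * ((`|beta| * `|a| + `|b|) - (b * g) * (1 - `|beta|)) / (`|a| + `|b|).
  by rewrite /X /Y; field.
by rewrite bg [in RHS]be; field.
Qed.
End Twist.

Section UnitaryOnCircle.
Variable R : realType.
Local Notation C := (R[i]).

(** The entries are those of U^* A U for U := [ x, -conj y ; y, conj x ]; the
    columns of A U are (p1, q1) and (p2, q2). *)
Lemma contraction_unitary_conj (a b c d x y : C) : `|x| ^+ 2 + `|y| ^+ 2 = 1 ->
  contraction a b c d ->
  let p1 := a * x + b * y in let q1 := c * x + d * y in
  let p2 := b * x^* - a * y^* in let q2 := d * x^* - c * y^* in
  contraction (x^* * p1 + y^* * q1) (x^* * p2 + y^* * q2)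
                (x * q1 - y * p1) (x * q2 - y * p2).
Proof.
move=> xy1 Kon p1 q1 p2 q2 v w.
have xy1' : `|x^*| ^+ 2 + `|- y| ^+ 2 = 1 by rewrite norm_conjC normrN.
have := Kon (x * v - y^* * w) (y * v + x^* * w).
rewrite isometry_unitary2//.
rewrite -(isometry_unitary2 (a * (x * v - y^* * w) + b * (y * v + x^* * w))
   (c * (x * v - y^* * w) + d * (y * v + x^* * w)) xy1').
rewrite rmorphN /= conjCK.
apply: le_trans; rewrite le_eqVlt; apply/orP; left; apply/eqP.
by congr (_ + _); congr (_ ^+ 2); congr (Num.norm _); rewrite /p1 /q1 /p2 /q2; ring.
Qed.

(** Unitary conjugation leaves trace and determinant unchanged and turns the lower
    left entry of [ h, b ; a, h ] into a x ^ 2 - b y ^ 2. *)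
Lemma closed_pentablock_twist (h a b beta : C) :
  contraction h b a h -> a != 0 -> `|beta| <= 1 ->
  closed_pentablock (beta * a, 2 * h, h ^+ 2 - a * b).
Proof.
move=> Kon a0 beta1.
have [x [y [xy1 E]]] := exists_twist b a0 beta1.
have := closed_pentablock_contraction (contraction_unitary_conj xy1 Kon).
move: xy1; rewrite !normCK => xy1.
congr closed_pentablock; congr (_, _, _).
- by rewrite -E; ring.
- transitivity ((x * x^* + y * y^*) * (2 * h)); first by ring.
  by rewrite xy1 mul1r.
- transitivity ((x * x^* + y * y^*) ^+ 2 * (h ^+ 2 - a * b)); first by ring.
  by rewrite xy1 expr1n mul1r.
Qed.

(** The hypotheses say that A := [ E, -S ; T, E ] / D is unitary on the circle.  The
    maximum principle applies to the scalar functions <A v, u>, with v and u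
    fixed; taking u = A(z) v yields |A(z) v| <= |v|. *)
Lemma contraction_on_disc (E S T D : {poly C}) :
  (forall z, `|z| <= 1 -> D.[z] != 0) ->
  (forall z, `|z| = 1 -> `|E.[z]| ^+ 2 + `|S.[z]| ^+ 2 = `|D.[z]| ^+ 2) ->
  (forall z, `|z| = 1 -> `|T.[z]| = `|S.[z]|) ->
  (forall z, `|z| = 1 -> T.[z] * E.[z]^* = E.[z] * S.[z]^*) ->
  forall z, `|z| < 1 -> contraction (E.[z] / D.[z]) (- S.[z] / D.[z])
                                      (T.[z] / D.[z]) (E.[z] / D.[z]).
Proof.
move=> D0 ESD TS ort z z1 v w.
have Dz := D0 z (ltW z1).
pose P := v *: E - w *: S; pose Q := v *: T + w *: E.
have -> : E.[z] / D.[z] * v + - S.[z] / D.[z] * w = P.[z] / D.[z].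
  by rewrite /P !hornerE; field.
have -> : T.[z] / D.[z] * v + E.[z] / D.[z] * w = Q.[z] / D.[z].
  by rewrite /Q !hornerE; field.
set V := `|v| ^+ 2 + `|w| ^+ 2.
pose tau := `|P.[z]| ^+ 2 + `|Q.[z]| ^+ 2.
have V0 : 0 <= V by rewrite addr_ge0 ?exprn_ge0.
have tau0 : 0 <= tau by rewrite addr_ge0 ?exprn_ge0.
have D2 : 0 < `|D.[z]| ^+ 2 by rewrite exprn_gt0// normr_gt0.
rewrite !normrM normfV !exprMn -mulrDl exprVn ler_pdivrMr// -/tau.
have [->|taun] := eqVneq tau 0; first by rewrite mulr_ge0// ltW.
have Vn : V != 0.
  apply: contraNneq taun => /eqP; rewrite /V paddr_eq0 ?exprn_ge0//.
  rewrite !expf_eq0 !normr_eq0 /= => /andP[/eqP v0 /eqP w0].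
  by rewrite /tau /P /Q v0 w0 !scale0r subr0 addr0 !horner0 normr0 expr0n addr0.
have circ u : `|u| = 1 -> `|P.[u]| ^+ 2 + `|Q.[u]| ^+ 2 = V * `|D.[u]| ^+ 2.
  move=> u1; have o1 := ort u u1; have o2 := congr1 Num.conj o1.
  rewrite !rmorphM /= !conjCK in o2.
  have n1 := TS u u1; move/(congr1 (fun x => x ^+ 2)): n1.
  rewrite -ESD// /V /P /Q !hornerE !normCK rmorphB rmorphD !rmorphM /= => n1.
  have -> : (v * E.[u] - w * S.[u]) * (v^* * E.[u]^* - w^* * S.[u]^*) +
   (v * T.[u] + w * E.[u]) * (v^* * T.[u]^* + w^* * E.[u]^*) =
   (v * v^* + w * w^*) * (E.[u] * E.[u]^*) + w * w^* * (S.[u] * S.[u]^*)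
   + v * v^* * (T.[u] * T.[u]^*) + v * w^* * (T.[u] * E.[u]^* - E.[u] * S.[u]^*)
   + w * v^* * (T.[u]^* * E.[u] - E.[u]^* * S.[u]) by ring.
  by rewrite n1 o1 o2; ring.
pose k := sqrtC (tau * V).
have k0 : 0 <= k by rewrite sqrtC_ge0 mulr_ge0.
have k2 : k ^+ 2 = tau * V by rewrite sqrtCK.
have kn : k != 0 by rewrite sqrtC_eq0 mulf_neq0.
have kD u : `|(k *: D).[u]| = k * `|D.[u]| by rewrite hornerZ normrM ger0_norm.
have : `|((P.[z])^* *: P + (Q.[z])^* *: Q).[z]| <= `|(k *: D).[z]|.
  apply: maximum_modulus z1 => u u1; first by rewrite hornerZ mulf_neq0// D0.
  rewrite kD -(@ler_pXn2r _ 2)// ?nnegrE ?mulr_ge0//.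
  rewrite hornerD !hornerZ (le_trans (cauchy_schwarz2 _ _ _ _))//.
  rewrite !norm_conjC (circ u u1).
  by rewrite exprMn k2 -mulrA lexx.
rewrite kD hornerD !hornerZ ![_^* * _]mulrC -!normCK -/tau ger0_norm// => H.
rewrite -(@ler_pM2l _ tau) ?lt_neqAle 1?eq_sym ?taun//.
rewrite mulrA -k2 -exprMn -expr2 ler_pXn2r// ?nnegrE ?mulr_ge0//.
Qed.

End UnitaryOnCircle.

(** * The numerator of s and the common denominator *)

Section Data.
Variable C : numClosedFieldType.
Implicit Types (z r : C) (s : seq C) (E : {poly C}).

Definition self_inversive n E := forall z, `|z| = 1 -> z ^+ n * (E.[z])^* = E.[z].

(** The factors z - alpha are completed by their reflections.  For eta on the
    circle the product Z of the z - eta is its own reflection up to a constant q of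
    modulus 1, and the square root of q makes Z self-inversive. *)
Lemma self_inversive_numerator (alpha eta : seq C) :
  (forall r, r \in alpha -> `|r| < 1) -> (forall r, r \in eta -> `|r| = 1) ->
  exists E, [/\ (size E <= (2 * size alpha + size eta).+1)%N, E != 0,
    self_inversive (2 * size alpha + size eta) E &
    forall z, `|z| <= 1 -> mup z E = count_mem z (alpha ++ eta)].
Proof.
move=> alpha1 eta1.
pose q : C := \prod_(r <- eta) (- r^*).
have q1 : `|q| = 1.
  rewrite normr_prod big_seq big1// => r /eta1 r1.
  by rewrite normrN norm_conjC r1.
have qE : refl_poly eta = q *: zeros_poly eta.
  rewrite /refl_poly /zeros_poly /q -mul_polyC.
  elim: eta eta1 {q q1} => [|r eta IH] eta1; first by rewrite !big_nil mul1r.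
  rewrite !big_cons IH; last by move=> x xe; apply: eta1; rewrite inE xe orbT.
  by rewrite refl_factor_circle ?eta1 ?mem_head// -mul_polyC polyCM mulrACA.
have k2 : sqrtC q ^+ 2 = q by rewrite sqrtCK.
have k1 : `|sqrtC q| = 1.
  by apply/eqP; rewrite -(@eqrXn2 _ 2)// ?ler01// -normrX k2 q1 expr1n.
have k0 : sqrtC q != 0 by rewrite -normr_gt0 k1.
have kk : (sqrtC q)^* * q = sqrtC q.
  by rewrite -[in X in _ * X]k2 expr2 mulrA [_^* * _]mulrC -normCK k1 expr1n mul1r.
exists (sqrtC q *: (zeros_poly alpha * refl_poly alpha * zeros_poly eta)).
split.
- rewrite size_scale// (leq_trans (size_polyMleq _ _))// size_zeros addnS /=.
  rewrite mul2n -addnn -addSn leq_add2r.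
  rewrite (leq_trans (size_polyMleq _ _))// size_zeros addSn /= -addnS leq_add2l.
  exact: size_refl.
- by rewrite scaler_eq0 (negPf k0) /= !mulf_neq0// ?zeros_neq0 ?refl_poly_neq0.
- move=> z z1; have zz := circle_mulJ z1.
  have := refl_circle eta z1; rewrite qE hornerZ => Z.
  rewrite hornerZ !hornerM refl_circle// !rmorphM rmorphXn /= conjCK.
  set A := (zeros_poly alpha).[z]; set B := (zeros_poly eta).[z].
  transitivity ((z * z^*) ^+ size alpha * z ^+ size alpha * (A * A^*) *
     (sqrtC q)^* * (z ^+ size eta * B^*)).
    by rewrite exprMn mul2n -addnn !exprD; ring.
  by rewrite -Z -/B zz expr1n -[in RHS]kk; ring.
- move=> z z1; rewrite -mul_polyC mupMr ?rootC// count_cat.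
  rewrite mupM ?zeros_neq0//; last by rewrite mulf_neq0// ?zeros_neq0 ?refl_poly_neq0.
  rewrite mupMl; last exact: refl_disc_neq0.
  by rewrite !mu_prod_XsubC.
Qed.

(** On the circle z ^- n times the right-hand side is |S|^2 + |E|^2, which is
    positive as S and E have no common zero there. *)
Lemma outer_denominator n (sigma : seq C) E : size sigma = n ->
  (size E <= n.+1)%N -> self_inversive n E ->
  (forall z, `|z| = 1 -> z \in sigma -> E.[z] != 0) ->
  exists D Dt : {poly C}, [/\ forall z, `|z| <= 1 -> D.[z] != 0,
    (size D <= n.+1)%N /\ (size Dt <= n.+1)%N,
    forall z, `|z| = 1 -> Dt.[z] = z ^+ n * (D.[z])^* &
    4 *: (D * Dt) = zeros_poly sigma * refl_poly sigma + E ^+ 2].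
Proof.
move=> szs szE Einv nocommon.
pose W := zeros_poly sigma * refl_poly sigma + E ^+ 2.
have szW : (size W <= (2 * n).+1)%N.
  rewrite (leq_trans (size_polyD _ _))// geq_max; apply/andP; split.
    rewrite (leq_trans (size_polyMleq _ _))// size_zeros szs addSn /=.
    by rewrite mul2n -addnn -addnS leq_add2l -szs size_refl.
  rewrite (leq_trans (size_polyMleq _ _))//.
  by case: (size E) szE => [|k]// kn; rewrite addSn /= addnS mul2n -addnn ltnS leq_add.
have Wpos z : `|z| = 1 -> 0 < W.[z] * z^* ^+ n.
  move=> z1; have zz := circle_mulJ z1.
  have -> : W.[z] * z^* ^+ n = `|(zeros_poly sigma).[z]| ^+ 2 + `|E.[z]| ^+ 2.
    have EE : E.[z] * z^* ^+ n = (E.[z])^*.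
      by rewrite -{1}Einv// mulrAC -exprMn zz expr1n mul1r.
    rewrite /W hornerD hornerM horner_exp mulrDl refl_circle// szs !normCK.
    congr (_ + _).
      by rewrite mulrCA mulrA -mulrA mulrAC -exprMn zz expr1n mul1r.
    by rewrite expr2 -mulrA EE.
  have [S0|S0] := eqVneq (zeros_poly sigma).[z] 0.
    rewrite S0 normr0 expr0n add0r exprn_gt0// normr_gt0 nocommon//.
    by rewrite -root_zeros; apply/eqP.
  by rewrite ltr_pwDl ?exprn_gt0 ?normr_gt0// exprn_ge0.
have [c [r [c0 szr r1 WE]]] := fejer_riesz szW Wpos.
have [k k0 k4] : exists2 k, 0 < k & 4 * (k * k) = c.
  exists (sqrtC c / 2); first by rewrite divr_gt0// sqrtC_gt0.
  by rewrite -[in RHS](sqrtCK c); field.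
have kn : k != 0 by rewrite gt_eqF.
have kJ : k^* = k by apply/CrealP; rewrite gtr0_real.
exists (k *: refl_poly r), (k *: zeros_poly r); split.
- by move=> z z1; rewrite hornerZ mulf_neq0// refl_disc_neq0.
- by rewrite !size_scale// size_zeros szr -szr size_refl.
- move=> z z1; rewrite !hornerZ refl_circle// !rmorphM rmorphXn /= conjCK kJ szr.
  by rewrite -[LHS]mul1r -(expr1n _ n) -(circle_mulJ z1) exprMn; ring.
- rewrite -/W WE -scalerAl -scalerAr !scalerA [refl_poly _ * _]mulrC.
  by rewrite -k4 !mulrA.
Qed.
End Data.

(** * Quotients of polynomials as rational functions *)

Section Ratfun.
Variable R : realType.
Local Notation C := (R[i]).
Implicit Types (P Q E D Dt : {poly C}) (f : ratfun R).

Definition polyfrac P Q : ratfun R := FracField.tofrac P / FracField.tofrac Q.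

Lemma lowest_terms P Q : Q != 0 ->
  exists g, P = rnum (polyfrac P Q) * g /\ Q = rden (polyfrac P Q) * g.
Proof.
move=> Q0; set f := polyfrac P Q.
have d0 := rden_neq0 f.
have E : rnum f * Q = P * rden f.
  have := ratfunE f; rewrite {1}/f /polyfrac => /eqP.
  by rewrite eqr_div ?tofrac_eq0// -!tofracM tofrac_eq => /eqP->.
have : rden f %| Q.
  have := coprimep_rnum_rden f; rewrite coprimep_sym => /Gauss_dvdpr <-.
  by rewrite E dvdp_mull.
move=> /dvdpP[g Qg]; exists g; split; last by rewrite mulrC.
by apply: (mulIf d0); rewrite -E {1}Qg -mulrA.
Qed.

(** Where Q does not vanish, poles, values and orders of zeros can be computed from
    P and Q even if they have common factors. *)
Lemma polyfrac_at P Q z : Q.[z] != 0 -> let f := polyfrac P Q in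
  [/\ ~~ pole f z, reval f z = P.[z] / Q.[z] & zero_order f z = mup z P].
Proof.
move=> Qz f.
have Q0 : Q != 0 by apply: contraNneq Qz => ->; rewrite horner0.
have [g [PE QE]] := lowest_terms P Q0; rewrite -/f in PE QE; clearbody f.
have := Qz; rewrite QE hornerM mulf_eq0 negb_or => /andP[dz gz].
split; first exact: dz.
  by rewrite /reval PE !hornerM -mulf_div divff// mulr1.
by rewrite /zero_order PE mupMl.
Qed.

Lemma royal_quotient (F : fieldType) (e d t : F) : d != 0 ->
  (e / d) ^+ 2 - 4 * (t / d) = (e ^+ 2 - 4 * (d * t)) / d ^+ 2.
Proof. by move=> d0; field. Qed.

Lemma polyfrac_royal E D Dt : D != 0 ->
  polyfrac E D ^+ 2 - 4 * polyfrac Dt D =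
  polyfrac (E ^+ 2 - 4 * (D * Dt)) (D ^+ 2).
Proof.
move=> D0; rewrite /polyfrac royal_quotient ?tofrac_eq0//.
by rewrite tofracB !mulr_natl tofracMn !tofracXn tofracM.
Qed.

Lemma polyfrac_deg P Q k : Q != 0 -> (size P <= k.+1)%N -> (size Q <= k.+1)%N ->
  (ratdeg (polyfrac P Q) <= k)%N.
Proof.
move=> Q0 szP szQ; have [g [PE QE]] := lowest_terms P Q0.
have g0 : g != 0 by apply: contraNneq Q0 => g0; rewrite QE g0 mulr0.
have divP : (size (rnum (polyfrac P Q)) <= size P)%N.
  have [P0|P0] := eqVneq P 0; last by rewrite dvdp_leq// {2}PE dvdp_mulr.
  move/eqP: PE; rewrite {1}P0 eq_sym mulf_eq0 (negPf g0) orbF => /eqP ->.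
  by rewrite size_poly0.
have divQ : (size (rden (polyfrac P Q)) <= size Q)%N.
  by rewrite dvdp_leq// {2}QE dvdp_mulr.
rewrite /ratdeg geq_max -!subn1 !leq_subLR !add1n.
by rewrite (leq_trans divP szP) (leq_trans divQ szQ).
Qed.
End Ratfun.

(** * The inner function *)

Section Construction.
Variable R : realType.
Local Notation C := (R[i]).
Variables (n : nat) (beta sigma : seq C) (E D Dt : {poly C}).
Hypothesis size_sigma : size sigma = n.
Hypothesis beta_disc : forall b, b \in beta -> `|b| < 1.
Hypothesis sigma_disc : forall b, b \in sigma -> `|b| <= 1.
Hypothesis E_inv : self_inversive n E.
Hypothesis D_neq0 : forall z, `|z| <= 1 -> D.[z] != 0.
Hypothesis D_circle : forall z, `|z| = 1 -> Dt.[z] = z ^+ n * (D.[z])^*.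
Hypothesis factorization :
  4 *: (D * Dt) = zeros_poly sigma * refl_poly sigma + E ^+ 2.

Let S := zeros_poly sigma.
Let T := refl_poly sigma.
Let Z := zeros_poly beta.
Let B := refl_poly beta.

(** The Blaschke product of the points beta is Z / B. *)
Definition pentaA := polyfrac (Z * T) ((2 *: D) * B).
Definition pentaS := polyfrac E D.
Definition pentaP := polyfrac Dt D.

Lemma two_neq0 : (2 : C) != 0. Proof. by rewrite pnatr_eq0. Qed.

Lemma D2_neq0 z : `|z| <= 1 -> (2 *: D).[z] != 0.
Proof. by move=> z1; rewrite hornerZ mulf_neq0 ?D_neq0 ?two_neq0. Qed.

Lemma B_neq0 z : `|z| <= 1 -> B.[z] != 0.
Proof. exact: refl_disc_neq0. Qed.

Lemma denA_neq0 z : `|z| <= 1 -> ((2 *: D) * B).[z] != 0.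
Proof. by move=> z1; rewrite hornerM mulf_neq0 ?B_neq0 ?D2_neq0. Qed.

Lemma T_circle z : `|z| = 1 -> T.[z] = z ^+ n * (S.[z])^*.
Proof. by move=> z1; rewrite /T refl_circle// size_sigma. Qed.

Lemma norm_circle z : `|z| = 1 ->
  `|E.[z]| ^+ 2 + `|S.[z]| ^+ 2 = `|(2 *: D).[z]| ^+ 2.
Proof.
move=> z1; have zz := circle_mulJ z1.
have zn : z ^+ n != 0 by rewrite expf_neq0// circle_neq0.
have := congr1 (fun P : {poly C} => P.[z]) factorization.
rewrite hornerZ !hornerM hornerD hornerM horner_exp -/S -/T D_circle// T_circle//.
rewrite [E.[z] ^+ 2]expr2 -{2}E_inv// => F.
apply: (mulfI zn); rewrite !normCK hornerZ rmorphM /= conjC_nat.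
transitivity (4 * (D.[z] * (z ^+ n * D.[z]^*))); last by ring.
by rewrite F; ring.
Qed.

Lemma Z_le_B z : `|z| < 1 -> `|Z.[z] / B.[z]| <= 1.
Proof.
move=> z1; have Bz : B.[z] != 0 by rewrite B_neq0// ltW.
rewrite normrM normfV ler_pdivrMr ?normr_gt0// mul1r.
apply: (@maximum_modulus R) z1 => [w|w w1]; first exact: B_neq0.
by rewrite /B norm_refl_circle.
Qed.

Lemma T_disc_neq0 z : `|z| < 1 -> T.[z] != 0.
Proof.
move=> z1; apply: horner_refl_neq0 => r /sigma_disc r1; rewrite normrM.
by rewrite (le_lt_trans _ z1)// ler_piMl.
Qed.

(** The matrix [ E, -S ; T, E ] / (2 D) has trace E / D and, by the factorization,
    determinant Dt / D; the twist multiplies T / (2 D) by Z / B. *)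
Lemma inner_disc z : `|z| < 1 ->
  closed_pentablock ((Z * T).[z] / (2 *: D * B).[z], E.[z] / D.[z], Dt.[z] / D.[z]).
Proof.
move=> z1; have z1' := ltW z1.
have D2z := D2_neq0 z1'; have Bz := B_neq0 z1'; have Dz := D_neq0 z1'.
have Tz := T_disc_neq0 z1.
have : contraction (E.[z] / (2 *: D).[z]) (- S.[z] / (2 *: D).[z])
                     (T.[z] / (2 *: D).[z]) (E.[z] / (2 *: D).[z]).
  apply: contraction_on_disc => // [w|w w1|w w1|w w1].
  - exact: D2_neq0.
  - exact: norm_circle.
  - exact: norm_refl_circle.
  - by rewrite T_circle// -[in RHS]E_inv//; ring.
move=> Kon.
have a0 : T.[z] / (2 *: D).[z] != 0 by rewrite mulf_neq0// invr_eq0.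
have := closed_pentablock_twist Kon a0 (Z_le_B z1).
have F := congr1 (fun P : {poly C} => P.[z]) factorization.
rewrite /= hornerZ !hornerM hornerD hornerM horner_exp -/S -/T in F.
rewrite !hornerZ in D2z *.
congr closed_pentablock; congr (_, _, _).
- by rewrite !hornerM hornerZ mulf_div [B.[z] * _]mulrC.
- by field; rewrite Dz.
- transitivity ((S.[z] * T.[z] + E.[z] ^+ 2) / (4 * D.[z] ^+ 2)).
    by field; rewrite Dz.
  by rewrite -F; field; rewrite Dz.
Qed.

Lemma inner_circle z : `|z| = 1 -> distinguished_boundary
  ((Z * T).[z] / (2 *: D * B).[z]) (E.[z] / D.[z]) (Dt.[z] / D.[z]).
Proof.
move=> z1; have z1' : `|z| <= 1 by rewrite z1.
have Bz := B_neq0 z1'; have Dz := D_neq0 z1'.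
have nD : 0 < `|D.[z]| by rewrite normr_gt0.
have DJ : D.[z]^* != 0 by rewrite conjC_eq0.
have := norm_circle z1; rewrite hornerZ normrM normr_nat => N.
split.
- rewrite normrM normfV ler_pdivrMr// -(@ler_pXn2r _ 2)// ?nnegrE ?mulr_ge0//.
  by rewrite -N lerDl exprn_ge0.
- by rewrite D_circle// !normrM normfV normrX z1 expr1n mul1r norm_conjC divff// gt_eqF.
- rewrite D_circle// -{1}E_inv// rmorphM fmorphV /=.
  by field; rewrite Dz.
- have nT : `|T.[z]| = `|S.[z]| by exact: norm_refl_circle.
  have nZ : `|Z.[z]| = `|B.[z]| by rewrite /B norm_refl_circle.
  rewrite -[LHS]sqrCK//; congr sqrtC.
  rewrite !hornerM hornerZ !normrM !normfV !normrM normr_nat nT nZ.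
  have nD0 : `|D.[z]| != 0 by rewrite gt_eqF.
  have nB0 : `|B.[z]| != 0 by rewrite normr_eq0.
  rewrite [(`|E.[z]| / _) ^+ 2]exprMn.
  have -> : `|E.[z]| ^+ 2 = (2 * `|D.[z]|) ^+ 2 - `|S.[z]| ^+ 2 by rewrite -N; ring.
  by field; rewrite nD0 nB0.
Qed.
End Construction.

Theorem theorem1p4 (R : realType) (n m k0 k1 : nat)
    (n_gt0 : (0 < n)%N) (m_gt0 : (0 < m)%N) (def_n : (2 * k0 + k1 = n)%N)
    (alpha : k0.-tuple R[i]) (eta : k1.-tuple R[i])
    (beta : m.-tuple R[i]) (sigma : n.-tuple R[i])
    (alpha_disc : forall j, disc (tnth alpha j))
    (eta_circle : forall j, circle (tnth eta j))
    (beta_disc : forall j, disc (tnth beta j))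
    (sigma_closed_disc : forall j, closed_disc (tnth sigma j))
    (sigma_eta : forall i j, tnth sigma i <> tnth eta j) :
  exists a s p : ratfun R,
    [/\ rational_penta_inner a s p,
        (ratdeg a <= m + n)%N /\ (ratdeg p <= n)%N,
        zeros_in (@disc R) a beta,
        zeros_in (@closed_disc R) s (alpha ++ eta)
      & royal_nodes s p sigma].
Proof.
have alpha1 r : r \in tval alpha -> `|r| < 1 by move=> /tnthP[j ->]; apply: alpha_disc.
have eta1 r : r \in tval eta -> `|r| = 1 by move=> /tnthP[j ->]; apply: eta_circle.
have beta1 r : r \in tval beta -> `|r| < 1 by move=> /tnthP[j ->]; apply: beta_disc.
have sigma1 r : r \in tval sigma -> `|r| <= 1.
  by move=> /tnthP[j ->]; apply: sigma_closed_disc.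
have [E []] := self_inversive_numerator alpha1 eta1.
rewrite !size_tuple def_n => szE E0 Einv Emup.
have nocommon z : `|z| = 1 -> z \in tval sigma -> E.[z] != 0.
  move=> z1 zs; have z1' : `|z| <= 1 by rewrite z1.
  have : mup z E == 0%N.
    rewrite Emup//; apply/eqP/count_memPn.
    rewrite mem_cat negb_or; apply/andP; split; apply/negP.
      by move=> /alpha1; rewrite z1 ltxx.
    by move: zs => /tnthP[i ->] /tnthP[j /sigma_eta].
  by rewrite -leqn0 leqNgt -XsubC_dvd// dvdp_XsubCl.
have [D [Dt [D0 [szD szDt] Dcirc F]]] :=
  outer_denominator (size_tuple sigma) szE Einv nocommon.
have szs := size_tuple sigma.
have Dn : D != 0.
  by apply: contraTneq (D0 0 _) => [->|]; rewrite ?horner0 ?eqxx// normr0 ler01.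
have den0 := denA_neq0 beta1 D0.
have tofrac_neq0 (P Q : {poly R[i]}) : P != 0 -> Q != 0 -> polyfrac P Q != 0.
  by move=> P0 Q0; rewrite mulf_neq0 ?invr_eq0 ?tofrac_eq0.
have S0 := zeros_neq0 sigma; have Z0 := zeros_neq0 beta.
have T0 := refl_poly_neq0 sigma.
have dn : 2 *: D * refl_poly beta != 0.
  by apply: contraTneq (den0 0 _) => [->|]; rewrite ?horner0 ?eqxx// normr0 ler01.
have atA z z1 := polyfrac_at (zeros_poly beta * refl_poly sigma) (den0 z z1).
have atS z z1 := polyfrac_at E (D0 z z1).
have atP z z1 := polyfrac_at Dt (D0 z z1).
exists (pentaA beta sigma D), (pentaS E D), (pentaP D Dt); split.
- split=> z z1.
  + by have [? _ _] := atA z z1; have [? _ _] := atS z z1; have [? _ _] := atP z z1.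
  + have z1' : `|z| <= 1 := ltW z1.
    have [_ -> _] := atA z z1'; have [_ -> _] := atS z z1'; have [_ -> _] := atP z z1'.
    exact: (inner_disc szs).
  + have z1' : `|z| <= 1 by rewrite z1.
    have [_ -> _] := atA z z1'; have [_ -> _] := atS z z1'; have [_ -> _] := atP z z1'.
    exact: (inner_circle szs).
- split; apply: polyfrac_deg => //.
    rewrite (leq_trans (size_polyMleq _ _))// size_zeros size_tuple addSn /=.
    by rewrite -addnS leq_add2l -{2}szs size_refl.
  rewrite (leq_trans (size_polyMleq _ _))// size_scale ?two_neq0//.
  have := leq_add szD (size_refl beta); rewrite size_tuple.
  by case: (_ + _)%N => [|k]//=; lia.
- split; first by rewrite tofrac_neq0// mulf_neq0.
  move=> z z1; have [_ _ ->] := atA z (ltW z1).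
  by rewrite mupMl ?mu_prod_XsubC//; apply: T_disc_neq0.
- split; first exact: tofrac_neq0.
  by move=> z z1; have [_ _ ->] := atS z z1; rewrite Emup.
- rewrite /royal_nodes.
  have -> : pentaS E D ^+ 2 - 4 * pentaP D Dt =
      polyfrac (- (zeros_poly sigma * refl_poly sigma)) (D ^+ 2).
    rewrite polyfrac_royal//; congr polyfrac.
    by rewrite mulr_natl -scaler_nat F; ring.
  split; first by rewrite tofrac_neq0 ?oppr_eq0 ?mulf_neq0 ?expf_neq0.
  move=> z z1.
  have D2z : (D ^+ 2).[z] != 0 by rewrite horner_exp expf_neq0 ?D0.
  have [_ _ ->] := polyfrac_at (- (zeros_poly sigma * refl_poly sigma)) D2z.
  rewrite -mulN1r mupMr; last by rewrite rootN ?root1.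
  rewrite mupM// mu_prod_XsubC mup_refl//.
  by case: ifP => _; rewrite ?addn0// mul2n addnn.
Qed.
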